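(* Let $\mathbf{X}_1,\mathbf{X}_2,\mathbf{X}_3$ be (possibly different) BNM schemes, and let $\mathbb{SS}$, $\mathbb{TT}$, $\mathbb{ST}$ be the sets of inferences valid according to the standard $\mathbf{ss}$ over $\mathbf{X}_1$, the standard $\mathbf{tt}$ over $\mathbf{X}_2$, and the standard $\mathbf{st}$ over $\mathbf{X}_3$, respectively. Then $$T(\mathbb{SS}\cup\mathbb{TT})=\mathbb{ST},$$ where $T$ denotes transitive closure.
   Context: Formulas: the propositional language $\mathcal{L}$ is built from a denumerably infinite set $\mathit{Var}$ of propositional variables using only $\neg$, $\lor$, $\wedge$ (no propositional constants). An inference $\Gamma\Rightarrow\phi$ is an ordered pair $\langle\Gamma,\phi\rangle$ with $\Gamma\subseteq\mathcal{L}$ finite (possibly empty) and $\phi\in\mathcal{L}$. Schemes: a (three-valued) scheme $\mathbf{X}$ is a triple $(f_\neg,f_\wedge,f_\vee)$ of operations on $\{0,\frac12,1\}$ (unary, binary, binary). It is Boolean normal if each operation, restricted to arguments in $\{0,1\}$, agrees with the corresponding operation of the two-element Boolean algebra. Let $\leq_{\rm I}$ be the partial order on $\{0,\frac12,1\}$ whose strict part is $\frac12<_{\rm I}0$ and $\frac12<_{\rm I}1$. The scheme is monotonic if each of its operations is monotone from the componentwise order induced by $\leq_{\rm I}$ to $\leq_{\rm I}$. A BNM scheme is a Boolean normal monotonic scheme. An $\mathbf{X}$-valuation is a map $v:\mathcal{L}\to\{0,\frac12,1\}$ such that $v(\neg\phi)=f_\neg(v(\phi))$, $v(\phi\wedge\psi)=f_\wedge(v(\phi),v(\psi))$,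 $v(\phi\vee\psi)=f_\vee(v(\phi),v(\psi))$. Standards: let $\mathbf{s}=\{1\}$ and $\mathbf{t}=\{1,\frac12\}$. For $\mathbf{x},\mathbf{y}\in\{\mathbf{s},\mathbf{t}\}$, a valuation $v$ satisfies $\Gamma\Rightarrow\phi$ according to $\mathbf{xy}$ if: whenever $v(\gamma)\in\mathbf{x}$ for all $\gamma\in\Gamma$, then $v(\phi)\in\mathbf{y}$. An inference is valid according to $\mathbf{xy}$ over $\mathbf{X}$ if it is satisfied according to $\mathbf{xy}$ by every $\mathbf{X}$-valuation. Transitive closure: for a set of inferences $\mathbb{L}$, $T(\mathbb{L})$ is the least set $\mathbb{L}'\supseteq\mathbb{L}$ of inferences such that, for all $\Gamma,\phi$: if there is a (finite) $\Delta\neq\emptyset$ with $\Delta\Rightarrow\phi\in\mathbb{L}'$ and $\Gamma\Rightarrow\delta\in\mathbb{L}'$ for all $\delta\in\Delta$, then $\Gamma\Rightarrow\phi\in\mathbb{L}'$. *)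

(* Defs.v *)
From HB Require Import structures.
From mathcomp Require Import all_boot.
From mathcomp Require Import finmap.
From mathcomp Require Import boolp classical_sets.

Set Implicit Arguments.
Unset Strict Implicit.
Unset Printing Implicit Defensive.

Local Open Scope classical_set_scope.

(* The variables are indexed by nat; there are no propositional constants. *)
Inductive formula : Type :=
  | Var of nat
  | Neg of formula
  | And of formula & formula
  | Or of formula & formula.

(* A countable-type structure on formulas, needed to form {fset formula}. *)
Fixpoint encode_formula (f : formula) : GenTree.tree nat :=
  match f with
  | Var n => GenTree.Leaf n
  | Neg a => GenTree.Node 0 [:: encode_formula a]
  | And a b => GenTree.Node 1 [:: encode_formula a; encode_formula b]
  | Or a b => GenTree.Node 2 [:: encode_formula a; encode_formula b]
  end.

Fixpoint decode_formula (t : GenTree.tree nat) : option formula :=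
  match t with
  | GenTree.Leaf n => Some (Var n)
  | GenTree.Node 0 [:: a] => omap Neg (decode_formula a)
  | GenTree.Node 1 [:: a; b] =>
      if decode_formula a is Some a' then omap (And a') (decode_formula b)
      else None
  | GenTree.Node 2 [:: a; b] =>
      if decode_formula a is Some a' then omap (Or a') (decode_formula b)
      else None
  | _ => None
  end.

Lemma encode_formulaK : pcancel encode_formula decode_formula.
Proof. by elim=> //= [a -> | a -> b -> | a -> b ->]. Qed.

HB.instance Definition _ := Countable.copy formula (pcan_type encode_formulaK).

Definition inference : Type := ({fset formula} * formula)%type.

Inductive val3 : Type := Zero | Half | One.

Definition val_of_bool (b : bool) : val3 := if b then One else Zero.

(* The reflexive order whose strict part is Half < Zero and Half < One. *)
Definition le_info (x y : val3) : Prop := x = y \/ x = Half.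

Record scheme : Type := Scheme {
  f_neg : val3 -> val3;
  f_and : val3 -> val3 -> val3;
  f_or : val3 -> val3 -> val3 }.

Definition boolean_normal (X : scheme) : Prop :=
  [/\ forall a, f_neg X (val_of_bool a) = val_of_bool (~~ a),
      forall a b, f_and X (val_of_bool a) (val_of_bool b) = val_of_bool (a && b)
    & forall a b, f_or X (val_of_bool a) (val_of_bool b) = val_of_bool (a || b)].

Definition monotonic (X : scheme) : Prop :=
  [/\ forall x x', le_info x x' -> le_info (f_neg X x) (f_neg X x'),
      forall x x' y y', le_info x x' -> le_info y y' ->
        le_info (f_and X x y) (f_and X x' y')
    & forall x x' y y', le_info x x' -> le_info y y' ->
        le_info (f_or X x y) (f_or X x' y')].

Definition BNM (X : scheme) : Prop := boolean_normal X /\ monotonic X.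

Definition valuation (X : scheme) (v : formula -> val3) : Prop :=
  [/\ forall a, v (Neg a) = f_neg X (v a),
      forall a b, v (And a b) = f_and X (v a) (v b)
    & forall a b, v (Or a b) = f_or X (v a) (v b)].

Definition strict : set val3 := [set One].
Definition tolerant : set val3 := [set One; Half].

Definition satisfies (x y : set val3) (v : formula -> val3) (i : inference) :
    Prop :=
  (forall g, g \in i.1 -> x (v g)) -> y (v i.2).

Definition valid (x y : set val3) (X : scheme) : set inference :=
  [set i | forall v, valuation X v -> satisfies x y v i].

Definition transitive_closed (L : set inference) : Prop :=
  forall (G : {fset formula}) (p : formula),
    (exists D : {fset formula},
        [/\ D != fset0, L (D, p) & forall d, d \in D -> L (G, d)]) ->
    L (G, p).

Definition transitive_closure (L : set inference) : set inference :=
  smallest transitive_closed L.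

(* Main.v *)
Require Import Defs.
From mathcomp Require Import all_boot.
From mathcomp Require Import finmap.
From mathcomp Require Import boolp classical_sets.

(** Over every BNM scheme, [valid strict tolerant] is classical validity.
    Boolean assignments are valuations of every Boolean normal scheme, so the
    inferences valid by ss, tt or st are all classically valid; conversely a
    strict-tolerant counterexample, with premises [One] and conclusion [Zero],
    can be sharpened by monotonicity to a Boolean assignment giving the same
    extreme values ([sharpening]).  Classical validity is closed under cut and
    contains both SS and TT, which gives one inclusion.

    For the other, a classically valid inference G => p is obtained by a single
    cut, a TT step followed by an SS step, on the formula
      D  :=  (g1 & ~g1) or ... or (gn & ~gn) or p,    G = {g1, ..., gn}.
    In every BNM scheme a disjunction is [Zero] only if both disjuncts are, and
    g & ~g is [Zero] exactly when g has a Boolean value.  So D = [Zero] forces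
    p = [Zero] and all premises to be Boolean; sharpening leaves the premises
    untouched, and one of them must then be [Zero]: this is G => D in TT.  On
    the other hand g & ~g is never [One], and a disjunction with value [One]
    has a disjunct with value [One]; so D = [One] forces p = [One]: this is
    D => p in SS.  The same D serves whatever the schemes. *)

Local Open Scope classical_set_scope.

Fixpoint beval (e : nat -> bool) (f : formula) : bool :=
  match f with
  | Var n => e n
  | Neg a => ~~ beval e a
  | And a b => beval e a && beval e b
  | Or a b => beval e a || beval e b
  end.

Definition classically_valid : set inference :=
  [set i | forall e, (forall g, g \in i.1 -> beval e g) -> beval e i.2].

Lemma boolean_valuation X e :
  boolean_normal X -> valuation X (fun f => val_of_bool (beval e f)).
Proof. by case=> hn ha ho; split=> * /=; rewrite ?hn ?ha ?ho. Qed.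

(** The variables with value [Half] may be given any Boolean value:
    monotonicity propagates the comparison from variables to formulas. *)
Lemma sharpening X v : BNM X -> valuation X v ->
  exists e, forall f, le_info (v f) (val_of_bool (beval e f)).
Proof.
case=> -[bn ba bo] [mn ma mo] [vn va vo].
exists (fun n => if v (Var n) is One then true else false).
elim=> [n | a IH | a IHa b IHb | a IHa b IHb] /=.
- by case: (v (Var n)); [left | right | left].
- by rewrite vn -bn; apply: mn.
- by rewrite va -ba; apply: ma.
- by rewrite vo -bo; apply: mo.
Qed.

Lemma le_info_boolean x b :
  x <> val_of_bool (~~ b) -> le_info x (val_of_bool b).
Proof. by case: x; case: b => //= _; [left | right | right | left]. Qed.

Lemma boolean_of_le_info b b' :
  le_info (val_of_bool b) (val_of_bool b') -> b = b'.
Proof. by case: b; case: b' => -[]. Qed.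

Lemma strict_boolean b : strict (val_of_bool b) <-> b.
Proof. by case: b. Qed.

Lemma tolerant_boolean b : tolerant (val_of_bool b) <-> b.
Proof. by case: b; split=> //; [left | case]. Qed.

Lemma tolerantE x : tolerant x <-> x <> Zero.
Proof. by case: x; split=> //; [case | right | left]. Qed.

(** Any standards that recognise truth among the Boolean values will do,
    because Boolean assignments are themselves valuations of the scheme. *)
Lemma valid_classical (x y : set val3) X :
    (forall b, x (val_of_bool b) <-> b) -> (forall b, y (val_of_bool b) <-> b) ->
  boolean_normal X -> valid x y X `<=` classically_valid.
Proof.
move=> hx hy hX i hi e hG.
by apply/hy/(hi _ (boolean_valuation X e hX)) => g /hG /hx.
Qed.

Lemma valid_st_classical X :
  BNM X -> valid strict tolerant X = classically_valid.
Proof.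
move=> hX; apply/seteqP; split.
  exact: (valid_classical _ _ _ strict_boolean tolerant_boolean hX.1).
move=> i hi v hv hG; apply/tolerantE => v0.
have [e he] := sharpening X v hX hv.
have: beval e i.2.
  apply: hi => g /hG vg; have := he g; rewrite vg.
  by move/(boolean_of_le_info true) <-.
have := he i.2; rewrite v0.
by move/(boolean_of_le_info false) <-.
Qed.

Lemma transitive_closed_classical : transitive_closed classically_valid.
Proof.
move=> G p [D [_ hDp hGD]] e hG; apply: hDp => d dD.
exact: (hGD d dD e hG).
Qed.

Section Tables.
Variables (X : scheme) (hX : BNM X).

(** This and the next three lemmas isolate what all BNM truth tables share;
    the tables themselves differ (weak, strong and one-sided Kleene). *)
Lemma or_zero x y : f_or X x y = Zero -> x = Zero /\ y = Zero.
Proof.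
case: hX => -[_ _ bo] [_ _ mo] h.
(* a disjunct other than Zero could be sharpened to One, making the whole One *)
have boolean z : exists b, le_info z (val_of_bool b).
  by case: z; [exists false; left | exists true; right | exists true; left].
have aux b b' : le_info x (val_of_bool b) -> le_info y (val_of_bool b') ->
    b || b' = false.
  move=> /mo/[apply]; rewrite bo h.
  by move/(boolean_of_le_info false) <-.
split; apply: contrapT => nz; have := le_info_boolean _ true nz.
  by have [b' hb'] := boolean y; move=> /aux/(_ hb').
by have [b hb] := boolean x; move/(aux _ _ hb); rewrite orbT.
Qed.

(** If neither disjunct were [One], both could be sharpened to [Zero], and the
    Boolean disjunction would then be [Zero] instead of [One]. *)
Lemma or_one x y : f_or X x y = One -> x <> One -> y = One.
Proof.
case: hX => -[_ _ bo] [_ _ mo] h /(le_info_boolean _ false) hx.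
apply: contrapT => /(le_info_boolean _ false) hy.
have := mo _ _ _ _ hx hy; rewrite h bo.
by move/(boolean_of_le_info true).
Qed.

(** The value must lie below both Boolean values, the negations of the two
    sharpenings of [Half]. *)
Lemma neg_half : f_neg X Half = Half.
Proof.
case: hX => -[bn _ _] [mn _ _].
have := mn _ _ (le_info_boolean Half true ltac:(by [])).
have := mn _ _ (le_info_boolean Half false ltac:(by [])).
by rewrite !bn /=; case: (f_neg X Half) => -[] // _ [].
Qed.

Lemma and_half : f_and X Half Half <> Zero.
Proof.
case: hX => -[_ ba _] [_ ma _] h.
have hle := le_info_boolean Half true ltac:(by []).
have := ma _ _ _ _ hle hle; rewrite ba h.
by move/(boolean_of_le_info false).
Qed.

Variables (v : formula -> val3) (hv : valuation X v).

(** A value [One] would survive sharpening, making a classical contradiction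
    true. *)
Lemma contradiction_not_one g : v (And g (Neg g)) <> One.
Proof.
have [e he] := sharpening X v hX hv => v1.
have := he (And g (Neg g)); rewrite v1.
by move/(boolean_of_le_info true); rewrite /= andbN.
Qed.

Lemma contradiction_zero g : v (And g (Neg g)) = Zero -> v g <> Half.
Proof.
case: hv => vn va _; rewrite va vn => + vg.
rewrite vg neg_half; exact: and_half.
Qed.

End Tables.

(** The cut formula: classically equivalent to [p], but [Zero] only when the
    formulas of [s] all take Boolean values. *)
Definition contradictions_or (s : seq formula) (p : formula) : formula :=
  foldr (fun g q => Or (And g (Neg g)) q) p s.

Lemma contradictions_or_one X v s p : BNM X -> valuation X v ->
  v (contradictions_or s p) = One -> v p = One.
Proof.
move=> hX hv; elim: s => //= g s IH; case: (hv) => _ _ -> h.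
exact/IH/(or_one X hX _ _ h)/(contradiction_not_one X hX).
Qed.

Lemma contradictions_or_zero X v s p : BNM X -> valuation X v ->
  v (contradictions_or s p) = Zero ->
  v p = Zero /\ forall g, g \in s -> v g <> Half.
Proof.
move=> hX hv; elim: s => //= g s IH; case: (hv) => _ _ -> /(or_zero X hX).
case=> /(contradiction_zero X hX v hv) hg /IH [hp hs]; split=> // h.
by rewrite inE => /predU1P[-> //|/hs].
Qed.

Lemma ss_contradictions_or X s p : BNM X ->
  valid strict strict X ([fset contradictions_or s p]%fset, p).
Proof.
move=> hX v hv hG; apply: (contradictions_or_one X v s) => //.
by apply: hG; rewrite inE.
Qed.

(** When the cut formula is [Zero], tolerantly true premises are Boolean,
    hence [One]; the valuation is then a strict-tolerant counterexample to
    [(G, p)], which sharpens to a classical one. *)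
Lemma tt_contradictions_or X (G : {fset formula}) p : BNM X ->
  classically_valid (G, p) ->
  valid tolerant tolerant X (G, contradictions_or G p).
Proof.
move=> hX hGp v hv hG; apply/tolerantE.
case/(contradictions_or_zero X v G p hX hv) => vp nhalf.
have [e he] := sharpening X v hX hv.
have: beval e p.
  apply: hGp => g gG; have := he g.
  (* tolerantly true and not Half, so strictly true, which sharpening keeps *)
  have [->|vg] := hG g gG; last by case: (nhalf g gG).
  by move/(boolean_of_le_info true) <-.
have := he p; rewrite vp.
by move/(boolean_of_le_info false) <-.
Qed.

Theorem theorem4p5 (X1 X2 X3 : scheme)
    (hX1 : BNM X1) (hX2 : BNM X2) (hX3 : BNM X3) :
  transitive_closure (valid strict strict X1 `|` valid tolerant tolerant X2)
  = valid strict tolerant X3.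
Proof.
rewrite valid_st_classical //; apply/seteqP; split.
  apply: smallest_sub; first exact: transitive_closed_classical.
  rewrite subUset; split.
    exact: (valid_classical _ _ _ strict_boolean strict_boolean hX1.1).
  exact: (valid_classical _ _ _ tolerant_boolean tolerant_boolean hX2.1).
move=> [G p] hGp L [hL subL]; apply: hL.
exists [fset contradictions_or G p]%fset; split.
- by apply/fset0Pn; exists (contradictions_or G p); rewrite inE.
- by apply: subL; left; apply: ss_contradictions_or.
- move=> d; rewrite inE => /eqP ->.
  by apply: subL; right; apply: tt_contradictions_or.
Qed.
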